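(* Let $G$ be a cubic, matching covered, bipartite graph. Then $G$ is cycle-conformal if and only if all braces of $G$ are cycle-conformal.
   Context: Graphs are finite, without loops or multiple edges. Cubic means $3$-regular. A graph is matching covered if it is connected, has at least four vertices, and each of its edges is contained in a perfect matching of it. A cycle $C \subseteq G$ is conformal if $G - V(C)$ has a perfect matching (the empty graph counts as having one). A graph is cycle-conformal if it has a perfect matching and all of its even cycles are conformal. For $X \subseteq V(G)$ let $\overline{X} = V(G)\setminus X$ and let the cut $\partial(X)$ be the set of edges with exactly one endpoint in $X$. In a matching covered graph $G$, a cut $\partial(X)$ is tight if $|M \cap \partial(X)| = 1$ for every perfect matching $M$ of $G$, and a tight cut is trivial if $|X|=1$ or $|\overline{X}|=1$. The two tight cut contractions of $G$ corresponding to $\partial(X)$ are the graphs obtained by contracting $X$, respectively $\overline{X}$, into a single vertex and deleting resulting loops and parallel edges; they are matching covered when $\partial(X)$ is non-trivial, and bipartite if $G$ is. Repeatedly taking tight cut contractions with respect to non-trivial tight cuts, starting with $G$, until no resulting graph has a non-trivial tight cut, yields a list of graphs that (by a theorem of Lovász) is, up to isomorphism, independent of the choices made. The bipartite graphs in this list are the braces of $G$ (if $G$ is bipartite, all graphs in the list are bipartite). A brace is a bipartite matching covered graph without non-trivial tight cuts. *)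

(* Defs.v *)
From Stdlib Require List.
From mathcomp Require Import all_boot.

Set Implicit Arguments.
Unset Strict Implicit.
Unset Printing Implicit Defensive.

Record sgraph := SGraph {
  vertex :> finType;
  adj : rel vertex;
  adj_sym : symmetric adj;
  adj_irrefl : irreflexive adj }.

Definition edges (G : sgraph) : {set {set G}} :=
  [set [set p.1; p.2] | p : G * G & adj p.1 p.2].

Definition cubic (G : sgraph) : Prop :=
  forall x : G, #|[set y | adj x y]| = 3.

Definition bipartite (G : sgraph) : Prop :=
  exists A : {set G}, forall x y : G, adj x y -> (x \in A) != (y \in A).

Definition connected (G : sgraph) : Prop :=
  forall x y : G, connect (@adj G) x y.

(* A matching is a set of edges, an edge being its two-element set of ends. *)
Definition perfect_matching (G : sgraph) (M : {set {set G}}) : bool :=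
  (M \subset edges G) && [forall x : G, #|[set f in M | x \in f]| == 1].

Definition has_perfect_matching (G : sgraph) : Prop :=
  exists M : {set {set G}}, perfect_matching M.

Definition matching_covered (G : sgraph) : Prop :=
  [/\ connected G, 4 <= #|G| &
      forall f : {set G}, f \in edges G ->
        exists M : {set {set G}}, perfect_matching M /\ f \in M].

Section Deletion.
Variables (G : sgraph) (X : {set G}).

Definition delete_adj : rel {x : G | x \notin X} :=
  fun u v => adj (val u) (val v).

Lemma delete_adj_sym : symmetric delete_adj.
Proof. by move=> u v; rewrite /delete_adj adj_sym. Qed.

Lemma delete_adj_irrefl : irreflexive delete_adj.
Proof. by move=> u; rewrite /delete_adj adj_irrefl. Qed.

Definition delete : sgraph := SGraph delete_adj_sym delete_adj_irrefl.

End Deletion.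

(* A cycle is listed by its vertices in cyclic order; the size bound excludes
   the closed walks of length at most 2 that [ucycle] accepts. *)
Definition is_cycle (G : sgraph) (c : seq G) : Prop :=
  3 <= size c /\ ucycle (@adj G) c.

Definition conformal (G : sgraph) (c : seq G) : Prop :=
  has_perfect_matching (delete [set x in c]).

Definition cycle_conformal (G : sgraph) : Prop :=
  has_perfect_matching G /\
  forall c : seq G, is_cycle c -> ~~ odd (size c) -> conformal c.

Definition cut (G : sgraph) (X : {set G}) : {set {set G}} :=
  [set f in edges G | #|f :&: X| == 1].

Definition tight (G : sgraph) (X : {set G}) : Prop :=
  forall M : {set {set G}}, perfect_matching M -> #|M :&: cut X| = 1.

Definition nontrivial (G : sgraph) (X : {set G}) : Prop :=
  #|X| <> 1 /\ #|~: X| <> 1.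

(* [None] is the vertex that X is contracted to. *)
Section Contraction.
Variables (G : sgraph) (X : {set G}).

Definition contract_adj : rel (option {x : G | x \notin X}) :=
  fun u v => match u, v with
  | Some x, Some y => adj (val x) (val y)
  | Some x, None => [exists z in X, adj (val x) z]
  | None, Some y => [exists z in X, adj (val y) z]
  | None, None => false
  end.

Lemma contract_adj_sym : symmetric contract_adj.
Proof. by move=> [x|] [y|] //=; rewrite adj_sym. Qed.

Lemma contract_adj_irrefl : irreflexive contract_adj.
Proof. by move=> [x|] //=; rewrite adj_irrefl. Qed.

Definition contract : sgraph := SGraph contract_adj_sym contract_adj_irrefl.

End Contraction.

(* [tight_cut_decomposition G L]: some run of the tight cut decomposition
   procedure, started with G, ends with the list L. *)
Inductive tight_cut_decomposition : sgraph -> seq sgraph -> Prop :=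
| Tcd_leaf (G : sgraph) :
    (forall X : {set G}, tight X -> ~ nontrivial X) ->
    tight_cut_decomposition G [:: G]
| Tcd_step (G : sgraph) (X : {set G}) (L1 L2 : seq sgraph) :
    tight X -> nontrivial X ->
    tight_cut_decomposition (contract X) L1 ->
    tight_cut_decomposition (contract (~: X)) L2 ->
    tight_cut_decomposition G (L1 ++ L2).

Definition brace_in (L : seq sgraph) (H : sgraph) : Prop :=
  List.In H L /\ bipartite H.

(* Main.v *)
Require Import Defs.
From mathcomp Require Import all_boot.

Set Implicit Arguments.
Unset Strict Implicit.
Unset Printing Implicit Defensive.

(** The theorem follows by induction along the decomposition from one statement
    about a single tight cut (cycles_conformal_tight_cut): all cycles of G are
    conformal if and only if this is so in both contractions of the cut.  In a
    bipartite graph every cycle is even, so parity never has to be tracked.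

    A contraction of a cubic graph loses parallel edges and need not be cubic,
    so the induction runs over simple graphs underlying cubic bipartite
    multigraphs in which every edge lies in a perfect matching (cubic_skeleton).
    This class is closed under tight cut contraction (contract_skeleton), and
    each of its tight cuts has total multiplicity 3 (cut_weight): the shore X
    has one vertex more in one colour class than in the other, all edges of the
    cut start in the larger class, and degrees are counted.  A cycle meets a cut
    in an even number of edges, so it crosses a tight cut at most twice
    (cycle_crosses_twice).

    From G to a contraction: a cycle that avoids the contracted vertex is a
    cycle of G.  One that passes through it becomes a cycle of G by a path
    inside X joining the ends of its two cut edges; such a path exists by parity
    of the components of G[X] (shore_path).  A matching avoiding the cycle in G,
    completed along the cycle so as to use one of its cut edges, is perfect and
    already has its unique cut edge there; so the matching stays within the
    shores and restricts to the contraction (cycles_conformal_contract).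

    From the contractions to G: a cycle inside a shore is a cycle of one
    contraction, and the matching obtained there is completed in the other shore
    by a perfect matching of G through its cut edge (shore_cycle_conformal).  A
    cycle that crosses the cut splits into one arc on either side, each of which
    closes to a cycle through a contracted vertex; the two matchings obtained
    live in disjoint shores and are glued (shore_arc_mates). *)

(** * Matchings as involutions *)

(** A perfect matching of the subgraph induced on S, as the map sending a vertex
    to its partner.  Values outside S are arbitrary, which lets one map serve as
    a matching of several sets. *)
Definition mates (G : sgraph) (S : {set G}) (f : G -> G) : Prop :=
  {in S, forall x, [/\ f x \in S, adj x (f x) & f (f x) = x]}.

Section Mates.
Variable G : sgraph.
Implicit Types (S T X A : {set G}) (f g : G -> G).

Lemma eq_mates S f g : {in S, f =1 g} -> mates S f -> mates S g.
Proof.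
by move=> eq_fg Sf x Sx; have [fS ? ?] := Sf x Sx; rewrite -!eq_fg.
Qed.

Lemma mates_inj S f : mates S f -> {in S &, injective f}.
Proof. by move=> Sf x y /Sf[_ _ fK] /Sf[_ _ fK'] eq_f; rewrite -fK eq_f. Qed.

Lemma matesU S T f : mates S f -> mates T f -> mates (S :|: T) f.
Proof.
by move=> Sf Tf x /setUP[/Sf[? ? ?]|/Tf[? ? ?]]; split; rewrite // inE;
   apply/orP; [left|right].
Qed.

Lemma matesD S T f : mates T f -> mates S f -> mates (T :\: S) f.
Proof.
move=> Tf Sf x /setDP[/Tf[fT xf fK] nSx]; split=> //; rewrite inE fT andbT.
by apply: contra nSx => /Sf[]; rewrite fK.
Qed.

Lemma mates_glue S T f g : [disjoint S & T] -> mates S f -> mates T g ->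
  exists h, [/\ mates (S :|: T) h, {in S, h =1 f} & {in T, h =1 g}].
Proof.
move=> dis Sf Tg; pose h x := if x \in S then f x else g x.
have hS : {in S, h =1 f} by move=> x Sx; rewrite /h Sx.
have hT : {in T, h =1 g}.
  by move=> x Tx; rewrite /h (disjointFl dis Tx).
exists h; split=> //; apply: matesU.
- by apply: eq_mates Sf => x /hS.
- by apply: eq_mates Tg => x /hT.
Qed.

(** Both restriction to a contraction and lifting from it are instances: only
    the matched pairs need to be sent to edges, which is what makes a section of
    the contraction map usable although it is no graph morphism. *)
Lemma mates_push (H : sgraph) (h : G -> H) S f :
  {in S &, injective h} -> mates S f ->
  {in S, forall x, adj (h x) (h (f x))} ->
  exists g : H -> H, mates (h @: S) g /\ {in S, forall x, g (h x) = h (f x)}.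
Proof.
move=> inj Sf hf.
pose g (u : H) : H := if [pick x in S | h x == u] is Some x then h (f x) else u.
have gh : {in S, forall x, g (h x) = h (f x)}.
  move=> x Sx; rewrite /g; case: pickP => [y /andP[Sy /eqP/inj->]|/(_ x)] //.
  by rewrite Sx eqxx.
exists g; split=> // u /imsetP[x Sx ->]; have [fS _ fK] := Sf x Sx.
by rewrite !gh // fK; split; rewrite ?imset_f ?hf.
Qed.

Lemma mates_balanced A S f :
    (forall x y : G, adj x y -> (x \in A) != (y \in A)) ->
  mates S f -> #|S :&: A| = #|S :\: A|.
Proof.
move=> bip Sf; have inj := mates_inj Sf; apply/eqP; rewrite eqn_leq.
have subS (B : {set G}) : B \subset S -> #|f @: B| = #|B|.
  by move=> /subsetP sub; apply: card_in_imset; apply: sub_in2 inj => x /sub.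
apply/andP; split.
- rewrite -(subS (S :&: A)) ?subsetIl //; apply/subset_leq_card/subsetP.
  move=> _ /imsetP[x /setIP[Sx Ax] ->]; have [fS /bip xf _] := Sf x Sx.
  by rewrite inE fS andbT; rewrite Ax in xf; case: (f x \in A) xf.
- rewrite -(subS (S :\: A)) ?subsetDl //; apply/subset_leq_card/subsetP.
  move=> _ /imsetP[x /setDP[Sx nAx] ->]; have [fS /bip xf _] := Sf x Sx.
  by rewrite inE fS; rewrite (negPf nAx) in xf; case: (f x \in A) xf.
Qed.

Lemma mates_even S f : bipartite G -> mates S f -> ~~ odd #|S|.
Proof.
case=> A bip Sf; rewrite -(cardsID A S) (mates_balanced bip Sf).
by rewrite addnn odd_double.
Qed.

Definition mates_edges f : {set {set G}} := [set [set x; f x] | x : G].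

Lemma in_edges (x y : G) : ([set x; y] \in edges G) = adj x y.
Proof.
apply/imsetP/idP => [[[a b] /= ab eq_xy]|xy]; last first.
  by exists (x, y); rewrite ?inE.
rewrite inE /= in ab.
have xE : x \in [set a; b] by rewrite -eq_xy set21.
have yE : y \in [set a; b] by rewrite -eq_xy set22.
have aE : a \in [set x; y] by rewrite eq_xy set21.
have bE : b \in [set x; y] by rewrite eq_xy set22.
have nab : a != b by apply: contraL ab => /eqP->; rewrite adj_irrefl.
case/set2P: xE => ex; case/set2P: yE => ey; subst; rewrite ?(adj_sym x) //.
- by rewrite setUid inE in bE; rewrite (eqP bE) eqxx in nab.
- by rewrite adj_sym.
- by rewrite setUid inE in aE; rewrite (eqP aE) eqxx in nab.
Qed.

(** The second conclusion is what transports a prescribed edge. *)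
Lemma perfect_matching_mates M : @perfect_matching G M ->
  exists2 f, mates setT f & forall x y, [set x; y] \in M -> f x = y.
Proof.
case/andP=> /subsetP sub /forallP one.
have ex x : exists y, [set x; y] \in M.
  have /cards1P[e def_e] := one x.
  have : e \in [set f in M | x \in f] by rewrite def_e set11.
  rewrite inE => /andP[Me xe].
  have /imsetP[[a b] /= _ def] := sub _ Me; subst e.
  by case/set2P: xe => ->; [exists b|exists a; rewrite setUC].
have uni x y z : [set x; y] \in M -> [set x; z] \in M -> y = z.
  move=> Mxy Mxz; have /cards1P[e def_e] := one x.
  have /set1P exy : [set x; y] \in [set e] by rewrite -def_e inE Mxy set21.
  have /set1P exz : [set x; z] \in [set e] by rewrite -def_e inE Mxz set21.
  have xy : adj x y by rewrite -in_edges sub.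
  have : y \in [set x; z] by rewrite exz -exy set22.
  by case/set2P=> // eq_yx; rewrite eq_yx adj_irrefl in xy.
pose f x := xchoose (ex x).
have fM x : [set x; f x] \in M by apply: (xchooseP (ex x)).
exists f => [x _|x y Mxy]; last by apply: uni Mxy.
split; rewrite ?inE //; first by rewrite -in_edges sub.
by apply: (uni (f x)) (fM _) _; rewrite setUC.
Qed.

Lemma mates_perfect_matching f :
  mates setT f -> perfect_matching (mates_edges f).
Proof.
move=> Tf; apply/andP; split.
  by apply/subsetP => _ /imsetP[x _ ->]; have [_ ? _] := Tf x (in_setT x);
     rewrite in_edges.
apply/forallP => x; apply/cards1P; exists [set x; f x]; apply/setP => e.
rewrite inE; apply/andP/set1P => [[/imsetP[y _ ->]]|->].
  by case/set2P=> -> //; have [_ _ ->] := Tf y (in_setT y); rewrite setUC.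
by rewrite set21; split=> //; apply/imsetP; exists x.
Qed.

Lemma has_perfect_matchingP :
  has_perfect_matching G <-> exists f, mates [set: G] f.
Proof.
split=> [[M /perfect_matching_mates[f]]|[f /mates_perfect_matching]].
  by exists f.
by exists (mates_edges f).
Qed.

End Mates.

Lemma delete_matesP (G : sgraph) (X : {set G}) :
  has_perfect_matching (delete X) <-> exists f, mates (~: X) f.
Proof.
rewrite has_perfect_matchingP; split=> [[f Tf]|[f Xf]].
  have vf : {in [set: delete X], forall x : delete X,
      adj (val x : G) (val (f x))}.
    by move=> x /Tf[].
  have inj : {in [set: delete X] &, injective (val : delete X -> G)}.
    by move=> x y _ _; apply: val_inj.
  have [g [gm _]] := mates_push inj Tf vf.
  exists g; suff <- : val @: [set: delete X] = ~: X by [].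
  apply/setP => x; rewrite inE; apply/imsetP/idP => [[u _ ->]|nXx].
    exact: (valP u).
  by exists (Sub x nXx).
pose g (u : delete X) : delete X := insubd u (f (val u)).
have vg u : val (g u) = f (val u).
  rewrite val_insubd; have [] := Xf (val u); rewrite ?inE ?(valP u) //.
  by move=> ->.
exists g => u _; have [] := Xf (val u); first by rewrite inE (valP u).
move=> _ uf fK; split; rewrite ?inE //; first by rewrite /= /delete_adj vg.
by apply: val_inj; rewrite !vg.
Qed.

(** * Tight cuts *)

Lemma in_cut (G : sgraph) (X : {set G}) (x y : G) :
  ([set x; y] \in cut X) = adj x y && ((x \in X) != (y \in X)).
Proof.
rewrite inE in_edges; case xy: (adj x y) => //=.
have nxy : x != y by apply: contraTneq xy => ->; rewrite adj_irrefl.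
rewrite setIUl cardsU -setIIl (_ : [set x] :&: [set y] = set0); last first.
  by apply/setP => z; rewrite !inE; apply/andP => -[/eqP-> /eqP]; apply/eqP.
rewrite set0I cards0 subn0.
suff cI z : #|[set z] :&: X| = (z \in X) by rewrite !cI; do 2!case: (_ \in X).
case: (boolP (z \in X)) => [zX|nzX].
  by rewrite (setIidPl _) ?cards1 ?sub1set.
by apply/eqP; rewrite cards_eq0 setI_eq0 disjoints1.
Qed.

Lemma tight_setC (G : sgraph) (X : {set G}) : tight X -> tight (~: X).
Proof.
move=> tX M /tX; suff -> : cut (~: X) = cut X by [].
apply/setP => e; case: (boolP (e \in edges G)) => [|nEe]; last first.
  by rewrite !inE (negPf nEe).
by case/imsetP=> [[x y] _ ->]; rewrite !in_cut !inE /=; do 2!case: (_ \in X).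
Qed.

(** The form in which tightness is used: the end a in X of the one edge that
    crosses, rather than a count of edges. *)
Lemma tight_mates (G : sgraph) (X : {set G}) f : tight X -> mates setT f ->
  exists a, [/\ a \in X, f a \notin X &
    {in X, forall x, f x \notin X -> x = a}].
Proof.
move=> tX Tf; have /eqP/cards1P[e def_e] := tX _ (mates_perfect_matching Tf).
have cross x : x \in X -> f x \notin X -> [set x; f x] = e.
  move=> xX nfX; apply/set1P; rewrite -def_e in_setI in_cut xX nfX andbT.
  apply/andP; split.
  - by apply/imsetP; exists x.
  - by have [_ -> _] := Tf x (in_setT x).
have : e \in [set e] by rewrite set11.
rewrite -def_e inE => /andP[/imsetP[x _ def] e_cut].
have [a [aX nfa ea]] : exists a, [/\ a \in X, f a \notin X & e = [set a; f a]].
  move: e_cut; rewrite def in_cut => /andP[_]; case xX: (x \in X).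
    by exists x; rewrite xX; split.
  case fX: (f x \in X) => // _; exists (f x); have [_ _ ->] := Tf x (in_setT x).
  by rewrite xX setUC.
exists a; split=> // y yX nfy; have := cross y yX nfy; rewrite ea => eq_ya.
have : y \in [set a; f a] by rewrite -eq_ya set21.
by case/set2P=> // ey; rewrite -ey yX in nfa.
Qed.

Lemma mates_shore (G : sgraph) (X : {set G}) f a : mates setT f -> a \in X ->
    f a \notin X -> {in X, forall x, f x \notin X -> x = a} ->
  mates (X :\ a) f.
Proof.
move=> Tf aX nfa uni x /setD1P[xa xX]; have [_ xf fK] := Tf x (in_setT x).
split=> //; rewrite !inE; apply/andP; split.
  by apply: contraNneq nfa => <-; rewrite fK.
by apply: contraR xa => nfx; rewrite (uni x).
Qed.

(** * Cycles of bipartite graphs *)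

(** The edges of a cycle that go forwards from one colour class form a perfect
    matching of it.  The colour class is chosen so that x is matched
    backwards. *)
Lemma cycle_mates (G : sgraph) (x : G) s : bipartite G ->
    ucycle (@adj G) (x :: s) ->
  exists2 f, mates [set y in x :: s] f & f x = last x s.
Proof.
case=> A bip /andP[cyc uni]; set c := x :: s in cyc uni *.
pose f y := if (y \in A) == (x \in A) then prev c y else next c y.
have yn y : y \in c -> adj y (next c y) by apply: next_cycle.
have py y : y \in c -> adj (prev c y) y by apply: prev_cycle.
exists f; last first.
  rewrite /f eqxx /c /= ; case/andP: uni => nxs _.
  have gen z t : x \notin t -> prev_at x x z t = last z t.
    elim: t z => [|u t IH] z /=; first by rewrite eqxx.
    by rewrite inE negb_or => /andP[/negPf-> /IH].
  by rewrite gen.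
move=> y; rewrite in_set => yc; rewrite in_set /f.
case: ifPn => yA.
  have := bip _ _ (py y yc); rewrite mem_prev yc adj_sym py //.
  by rewrite (eqP yA) => /negPf->; rewrite next_prev.
have := bip _ _ (yn y yc); rewrite mem_next yc yn //.
case: ifPn => [_|nA]; first by rewrite prev_next.
by move: yA nA; do 3!case: (_ \in A).
Qed.

Lemma bipartite_even_cycle (G : sgraph) (c : seq G) :
  bipartite G -> ucycle (@adj G) c -> ~~ odd (size c).
Proof.
case: c => // x s bip cyc; have [f Sf _] := cycle_mates bip cyc.
have := mates_even bip Sf; case/andP: cyc => _ /card_uniqP <-.
by rewrite cardsE.
Qed.

Definition conformal_mates (G : sgraph) (c : seq G) : Prop :=
  exists f, mates (~: [set x in c]) f.

Definition cycles_conformal (G : sgraph) : Prop :=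
  forall c : seq G, is_cycle c -> conformal_mates c.

Lemma bipartite_cycle_conformalP (G : sgraph) : bipartite G ->
  cycle_conformal G <->
  (exists f, mates [set: G] f) /\ cycles_conformal G.
Proof.
move=> bip; rewrite /cycle_conformal has_perfect_matchingP.
split=> -[ex cc]; split=> // c cyc.
  by apply/delete_matesP/cc => //; case: cyc => _; apply: bipartite_even_cycle.
by move=> _; apply/delete_matesP/cc.
Qed.

(** * Simple graphs underlying cubic bipartite multigraphs *)

(** The weight w is the multiplicity of an edge in the multigraph.  The covering
    condition is carried along since it restricts directly to contractions. *)
Record cubic_skeleton (G : sgraph) : Prop := CubicSkeleton {
  skeleton_bipartite : bipartite G;
  skeleton_mates : exists f, mates [set: G] f;
  skeleton_cover : forall x y : G, adj x y ->
    exists2 f, mates [set: G] f & f x = y;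
  skeleton_weight : exists w : G -> G -> nat,
    [/\ forall x y, w x y = w y x, forall x y, (0 < w x y) = adj x y &
        forall x, \sum_y w x y = 3] }.

Lemma cubic_cubic_skeleton (G : sgraph) :
  cubic G -> matching_covered G -> bipartite G -> cubic_skeleton G.
Proof.
move=> cub [_ n4 cov] bip.
have cov' (x y : G) : adj x y -> exists2 f, mates [set: G] f & f x = y.
  rewrite -in_edges => /cov[M [/perfect_matching_mates[f Tf Mf] Mxy]].
  by exists f; last exact: Mf.
split=> //; last first.
  exists (fun x y => adj x y : nat).
  split=> [x y|x y|x]; [by rewrite adj_sym|by rewrite lt0b|].
  rewrite -(cub x) -sum1_card [RHS]big_mkcond; apply: eq_bigr => y _.
  by rewrite /= inE; case: adj.
have /card_gt0P[x _] : 0 < #|G| by apply: leq_trans n4.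
have /card_gt0P[y] : 0 < #|[set y | adj x y]| by rewrite cub.
by rewrite inE => /cov'[f Tf _]; exists f.
Qed.

Section Shore.
Variables (G : sgraph) (X : {set G}).
Hypotheses (skG : cubic_skeleton G) (tX : tight X).

(** A perfect matching pairs off X except for the end a of its cut edge, so X
    has one vertex more in the class of a.  The imbalance does not depend on the
    matching, and every cut edge lies in some matching, so all cut edges start
    in the same class. *)
Lemma shore_colour : exists A : {set G},
  [/\ forall x y : G, adj x y -> (x \in A) != (y \in A),
      #|X :&: A| = #|X :\: A|.+1 &
      forall x y : G, adj x y -> x \in X -> y \notin X -> x \in A].
Proof.
have [f Tf] := skeleton_mates skG.
have [a [aX nfa uni]] := tight_mates tX Tf.
have [A bip aA] : exists2 A : {set G},
    forall x y : G, adj x y -> (x \in A) != (y \in A) & a \in A.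
  have [A bip] := skeleton_bipartite skG.
  case aA: (a \in A); first by exists A.
  exists (~: A); last by rewrite inE aA.
  by move=> x y /bip; rewrite !inE; do 2!case: (_ \in A).
(* b is the only vertex of X matched outside, so the rest is balanced. *)
have bal g b : mates [set: G] g -> b \in X -> g b \notin X ->
    {in X, forall x, g x \notin X -> x = b} ->
    (b \in A) + #|X :\: A| = (b \notin A) + #|X :&: A|.
  move=> Tg bX ngb unib.
  have := mates_balanced bip (mates_shore Tg bX ngb unib).
  have -> : (X :\ b) :&: A = (X :&: A) :\ b by rewrite setIDAC.
  have -> : (X :\ b) :\: A = (X :\: A) :\ b by rewrite !setDDl setUC.
  rewrite (cardsD1 b (X :&: A)) (cardsD1 b (X :\: A)) !inE bX andbT => ->.
  by rewrite /=; case: (b \in A).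
have eA := bal f a Tf aX nfa uni; rewrite aA add0n add1n in eA.
exists A; split=> // x y xy xX nyX.
have [g Tg gx] := skeleton_cover skG xy.
have [b [bX ngb unib]] := tight_mates tX Tg.
have ex : x = b by apply: unib => //; rewrite gx.
subst b; have := bal g x Tg bX ngb unib; rewrite -eA.
case: (x \in A) => // /eqP; rewrite add0n add1n -addn2.
by rewrite -[X in X == _]addn0 eqn_add2l.
Qed.

(** Since no cut edge starts in the smaller class, its 3 |X \ A| edge ends are
    met by edges to the larger class; the larger class has 3 more. *)
Lemma cut_weight (w : G -> G -> nat) :
    (forall x y, w x y = w y x) -> (forall x y, (0 < w x y) = adj x y) ->
    (forall x, \sum_y w x y = 3) ->
  \sum_(x in X) \sum_(y in ~: X) w x y = 3.
Proof.
move=> wC w_gt0 w3; have [A [bip excess out]] := shore_colour.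
have w0 x y : ~~ adj x y -> w x y = 0.
  by rewrite -w_gt0 -eqn0Ngt => /eqP.
have nadj x y : (x \in A) = (y \in A) -> ~~ adj x y.
  by move=> eA; apply/negP => /bip; rewrite eA eqxx.
have splitX (F : G -> nat) :
    \sum_(x in X) F x = \sum_(x in X :&: A) F x + \sum_(x in X :\: A) F x.
  by rewrite (big_setID A).
have outB : \sum_(x in X :\: A) \sum_(y in ~: X) w x y = 0.
  apply: big1 => x /setDP[xX nxA]; apply: big1 => y; rewrite inE => nyX.
  by apply: w0; apply: contra nxA => xy; apply: out xy xX nyX.
have deg x : \sum_(y in X) w x y + \sum_(y in ~: X) w x y = 3.
  rewrite -(w3 x) [RHS](bigID (mem X)) /=; congr (_ + _).
  by apply: eq_bigl => y; rewrite inE.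
have inA : \sum_(x in X :&: A) \sum_(y in X) w x y
           = \sum_(x in X :&: A) \sum_(y in X :\: A) w x y.
  apply: eq_bigr => x /setIP[_ xA]; rewrite splitX.
  rewrite (_ : \sum_(y in X :&: A) _ = 0) //; apply: big1 => y /setIP[_ yA].
  by apply/w0/nadj; rewrite xA yA.
have inB : \sum_(x in X :\: A) \sum_(y in X) w x y
           = \sum_(x in X :\: A) \sum_(y in X :&: A) w x y.
  apply: eq_bigr => x /setDP[_ /negPf xA]; rewrite splitX.
  rewrite (_ : \sum_(y in X :\: A) _ = 0) ?addn0 //.
  by apply: big1 => y /setDP[_ /negPf yA]; apply/w0/nadj; rewrite xA yA.
have sumA : \sum_(x in X :&: A) \sum_(y in X) w x y
            + \sum_(x in X :&: A) \sum_(y in ~: X) w x y = #|X :&: A| * 3.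
  rewrite -big_split /= (eq_bigr (fun _ => 3)) => [|x _]; last exact: deg.
  by rewrite sum_nat_const.
have sumB : \sum_(x in X :\: A) \sum_(y in X) w x y = #|X :\: A| * 3.
  rewrite -[LHS]addn0 -[X in _ + X = _]outB -big_split /=.
  rewrite (eq_bigr (fun _ => 3)) => [|x _]; last exact: deg.
  by rewrite sum_nat_const.
rewrite splitX outB addn0; apply/eqP.
rewrite -(eqn_add2l (#|X :\: A| * 3)) -{1}sumB inB exchange_big /=.
rewrite -[X in _ == _ + X]mul1n -mulnDl addn1 -excess -sumA inA.
by under eq_bigr => x _ do under eq_bigr => y _ do rewrite wC.
Qed.

(** Multiplicities are at least 1, so distinct cut edges number at most 3. *)
Lemma cut_cross_bound (s : seq (G * G)) : uniq s ->
    (forall p, p \in s -> [/\ p.1 \in X, p.2 \notin X & adj p.1 p.2]) ->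
  size s <= 3.
Proof.
move=> us cross; have [w [wC w_gt0 w3]] := skeleton_weight skG.
rewrite -(cut_weight wC w_gt0 w3) pair_big_dep /= -(card_uniqP us) -sum1_card.
rewrite [X in _ <= X](bigID (mem s)) /=; apply: leq_trans (leq_addr _ _).
rewrite [X in _ <= X](eq_bigl (mem s)) => [|p]; last first.
  rewrite !inE /=; case: (boolP (p \in s)) => [/cross[-> -> _]|] //.
  by rewrite andbF.
by apply: leq_sum => p /cross[_ _]; rewrite w_gt0.
Qed.

End Shore.

(** * Contraction of a tight cut *)

Section Contract.
Variables (G : sgraph) (X : {set G}).

Definition proj (x : G) : contract X := insub x.

(** A section of proj over the vertex z of X chosen to represent the contracted
    vertex; z stays free because the suitable one depends on a matching. *)
Definition unproj (z : G) (u : contract X) : G :=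
  if u is Some x then val x else z.

Lemma proj_None x : (proj x == None) = (x \in X).
Proof.
by rewrite /proj; case: insubP => [u nX _|/negPn ->] //; apply/esym/negbTE.
Qed.

Lemma unproj_proj z x : unproj z (proj x) = if x \in X then z else x.
Proof. by rewrite /proj; case: insubP => [u /negPf-> //|/negPn->]. Qed.

Lemma projK z x : x \notin X -> unproj z (proj x) = x.
Proof. by rewrite unproj_proj => /negPf->. Qed.

Lemma unprojK z : z \in X -> cancel (unproj z) proj.
Proof.
by move=> zX [x|]; [rewrite /proj /= valK|apply/eqP; rewrite proj_None].
Qed.

Lemma unproj_inj z : z \in X -> injective (unproj z).
Proof. by move=> zX; apply: can_inj (unprojK zX). Qed.

Lemma unproj_in z u : z \in X -> (unproj z u \in X) = (u == None).
Proof. by move=> zX; rewrite -proj_None unprojK. Qed.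

Lemma proj_eq x y : (proj x == proj y) = (x == y) || (x \in X) && (y \in X).
Proof.
rewrite -!proj_None; apply/eqP/orP => [|[/eqP->|/andP[/eqP-> /eqP->]]] //.
case: (boolP (x \in X)); rewrite -proj_None.
  by move/eqP=> -> <-; right; rewrite eqxx.
rewrite proj_None => nX e; left.
have nY : y \notin X by rewrite -proj_None -e proj_None.
by rewrite -(projK x nX) -(projK x nY) e.
Qed.

Lemma contract_adjP (u v : contract X) :
  reflect (u != v /\ exists x y, [/\ proj x = u, proj y = v & adj x y])
          (adj u v).
Proof.
have pv (x : {x : G | x \notin X}) : proj (val x) = Some x.
  by rewrite /proj valK.
have pX x : x \in X -> proj x = None by rewrite -proj_None => /eqP.
have Xp x : proj x = None -> x \in X by rewrite -proj_None => ->.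
have vp x y : proj x = Some y -> val y = x.
  by rewrite /proj; case: insubP => // ? _ <- [->].
apply: (iffP idP) => [uv|[nuv [x [y [xu yv xy]]]]].
  split; first by apply: contraTneq uv => ->; rewrite adj_irrefl.
  case: u v uv => [x|] [y|] //=.
  - by exists (val x), (val y).
  - by case/exists_inP=> z zX xz; exists (val x), z; rewrite pv pX.
  - by case/exists_inP=> z zX xz; exists z, (val y); rewrite pv pX // adj_sym.
case: u v xu yv nuv => [u|] [v|] // pu pv' _ /=.
- by rewrite (vp _ _ pu) (vp _ _ pv').
- by rewrite (vp _ _ pu); apply/exists_inP; exists y; rewrite ?Xp.
- by rewrite (vp _ _ pv'); apply/exists_inP; exists x; rewrite ?Xp // adj_sym.
Qed.

Lemma proj_adj x y : adj x y -> proj x != proj y -> adj (proj x) (proj y).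
Proof. by move=> xy ne; apply/contract_adjP; split=> //; exists x, y. Qed.

Lemma mates_proj (S : {set G}) f : {in S &, injective proj} -> mates S f ->
  exists g, mates (proj @: S) g /\ {in S, forall x, g (proj x) = proj (f x)}.
Proof.
move=> inj Sf; apply: mates_push => // x Sx; have [fS xf _] := Sf x Sx.
apply: proj_adj => //; apply: contraTneq xf => /inj e.
by rewrite -e ?adj_irrefl.
Qed.

(** Only one vertex of X is left in this set, so nothing is identified. *)
Lemma proj_inj_shore a : {in ~: (X :\ a) &, injective proj}.
Proof.
have aE x : x \in ~: (X :\ a) -> x \in X -> x = a.
  by rewrite !inE => /nandP[/negPn/eqP//|/negPf->].
move=> x y xS yS /eqP; rewrite proj_eq => /orP[/eqP//|/andP[xX yX]].
by rewrite (aE x xS xX) (aE y yS yX).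
Qed.

(** The multiplicity of an edge of the contraction is the sum of those of the
    edges of G above it; the contracted vertex has degree 3 by cut_weight. *)
Lemma contract_skeleton : cubic_skeleton G -> tight X ->
  cubic_skeleton (contract X).
Proof.
move=> skG tX.
(* A perfect matching crosses at one vertex a; dropping the rest of X leaves a
   matching that proj maps to a perfect matching of the contraction. *)
have full f : mates [set: G] f -> exists g : contract X -> contract X,
    mates setT g /\
    forall x, ~~ ((x \in X) && (f x \in X)) -> g (proj x) = proj (f x).
  move=> Tf; have [a [aX nfa uni]] := tight_mates tX Tf.
  have Sf := matesD Tf (mates_shore Tf aX nfa uni).
  have [|g [Sg gE]] := mates_proj _ Sf.
    by rewrite setTD; apply: proj_inj_shore.
  exists g; split.
    suff <- : proj @: ([set: G] :\: (X :\ a)) = setT by [].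
    apply/setP => u; rewrite inE; apply/imsetP.
    exists (unproj a u); last by rewrite unprojK.
    rewrite !inE andbT unproj_in // negb_and negbK.
    by case: u => [u|]; rewrite ?orbT //= eqxx.
  move=> x nin; apply: gE; rewrite !inE andbT; apply: contra nin.
  case/andP=> xa xX; rewrite xX /=; apply: contraR xa => nfx.
  by rewrite (uni x).
split.
(* All cut edges start in A, so the contracted vertex may be put in A. *)
- have [A [bip _ out]] := shore_colour skG tX.
  exists [set u | if u is Some x then val x \in A else true] => u v.
  wlog: u v / v != None => [IH|]; last first.
    case: v => [v|] // _ /contract_adjP[nuv [x [y [xu yv xy]]]].
    have nyX : y \notin X by rewrite -proj_None yv.
    rewrite !inE; have -> : val v = y by rewrite -(projK y nyX) yv.
    case: u xu nuv => [u|] xu _; last first.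
      have xX : x \in X by rewrite -proj_None xu.
      by have := bip _ _ xy; rewrite (out _ _ xy).
    have nxX : x \notin X by rewrite -proj_None xu.
    have -> : val u = x by rewrite -(projK y nxX) xu.
    exact: bip.
  case: v => [v|] uv; first exact: IH.
  by rewrite eq_sym; apply: IH; rewrite ?(adj_sym v) 1?adj_sym //; case: u uv.
- by have [f /full[g [Tg _]]] := skeleton_mates skG; exists g.
- move=> u v /contract_adjP[nuv [x [y [xu yv xy]]]].
  have [f Tf fx] := skeleton_cover skG xy; have [g [Tg gE]] := full f Tf.
  exists g => //; rewrite -xu gE fx ?yv //.
  by move: nuv; rewrite -xu -yv proj_eq negb_or => /andP[].
(* Edges inside X would make loops at the contracted vertex. *)
have [w [wC w_gt0 w3]] := skeleton_weight skG.
pose W (u v : contract X) := if u == v then 0 else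
   \sum_(x | proj x == u) \sum_(y | proj y == v) w x y.
exists W; split.
- move=> u v; rewrite /W eq_sym; case: eqP => // _; rewrite exchange_big /=.
  by do 2!apply: eq_bigr => ? _.
- move=> u v; rewrite /W; case: (eqVneq u v) => [->|nuv].
    by rewrite adj_irrefl.
  rewrite lt0n sum_nat_eq0 negb_forall.
  apply/existsP/contract_adjP => [[x]|[_]].
    rewrite negb_imply => /andP[/eqP xu]; rewrite sum_nat_eq0 negb_forall.
    case/existsP=> y; rewrite negb_imply -lt0n w_gt0 => /andP[/eqP yv xy].
    by split=> //; exists x, y.
  case=> x [y [xu yv xy]]; exists x; rewrite xu eqxx /= sum_nat_eq0 negb_forall.
  by apply/existsP; exists y; rewrite yv eqxx /= -lt0n w_gt0.
(* The degree of u is the weight of the cut around its fibre under proj. *)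
- move=> u; transitivity (\sum_(x | proj x == u) \sum_(y | proj y != u) w x y).
    rewrite [LHS](bigD1 u) //= {1}/W eqxx add0n.
    rewrite [RHS](eq_bigr (fun x =>
      \sum_(v | v != u) \sum_(y | proj y == v) w x y)); last first.
      move=> x _; rewrite (partition_big proj (fun v => v != u)) //=.
      apply: eq_bigr => v nvu; apply: eq_bigl => y.
      by case: (proj y =P v) => [->|]; rewrite ?nvu ?andbF.
    rewrite [RHS]exchange_big /=; apply: eq_bigr => v nvu.
    by rewrite /W eq_sym (negPf nvu).
  case: u => [u|].
    have uE x : (proj x == Some u) = (x == val u).
      rewrite -[Some u](_ : proj (val u) = _); last by rewrite /proj valK.
      by rewrite proj_eq (negPf (valP u)) andbF orbF.
    rewrite (eq_bigl _ _ uE) big_pred1_eq.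
    rewrite -(w3 (val u)) [RHS](bigD1 (val u)) //=.
    have -> : w (val u) (val u) = 0.
      by apply/eqP; rewrite eqn0Ngt w_gt0 adj_irrefl.
    by apply: eq_bigl => y; rewrite uE.
  rewrite -(cut_weight skG tX wC w_gt0 w3).
  rewrite (eq_bigl _ _ proj_None); apply: eq_bigr => x _.
  by apply: eq_bigl => y; rewrite proj_None inE.
Qed.

End Contract.

(** * Conformality passes to contractions *)

Lemma conformal_mates_rot (G : sgraph) n (c : seq G) :
  conformal_mates (rot n c) -> conformal_mates c.
Proof.
case=> f Sf; exists f.
rewrite (_ : [set x in c] = [set x in rot n c]) //.
by apply/setP => x; rewrite !inE mem_rot.
Qed.

Lemma is_cycle_rot (G : sgraph) n (c : seq G) :
  is_cycle c -> is_cycle (rot n c).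
Proof. by case=> sc uc; split; rewrite ?size_rot ?rot_ucycle. Qed.

Lemma adj_path_cons (H : sgraph) (x y : H) s :
  path (@adj H) x (y :: s) = adj x y && path (@adj H) y s.
Proof. by []. Qed.

Lemma cycle_cons2 (H : sgraph) (x u : H) p :
  cycle (@adj H) (x :: u :: p)
  = [&& adj x u, path (@adj H) u p & adj (last u p) x].
Proof. by rewrite /= rcons_path. Qed.

Section Transfer.
Variables (G : sgraph) (X : {set G}).
Hypotheses (skG : cubic_skeleton G) (tX : tight X).

Lemma crossing_mates (x y : G) : adj x y -> x \in X -> y \notin X ->
  exists f, [/\ mates [set: G] f, f x = y & mates (X :\ x) f].
Proof.
move=> xy xX nyX; have [f Tf fx] := skeleton_cover skG xy.
have [a [aX nfa uni]] := tight_mates tX Tf; exists f; split=> //.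
by rewrite (uni x) ?fx //; apply: mates_shore.
Qed.

(** Let K be the component of x in G[X].  A perfect matching crossing at y
    outside K matches K with itself, so |K| is even; one crossing at x matches
    K minus x with itself, so |K| is odd. *)
Lemma shore_path (x y x' y' : G) : x \in X -> y \in X ->
    x' \notin X -> y' \notin X -> adj x x' -> adj y y' ->
  exists q, [/\ path (@adj G) x q, last x q = y, uniq (x :: q)
              & {subset x :: q <= X}].
Proof.
move=> xX yX nx'X ny'X xx' yy'.
pose e : rel G := fun u v => [&& adj u v, u \in X & v \in X].
suff : connect e x y.
  case/connectP=> p ep ->; case/shortenP: ep => q eq uq _; exists q.
  split=> //; first by apply: sub_path eq => u v /and3P[].
  move=> z; rewrite inE => /predU1P[->//|zq].
  elim: q x {xX xx' uq} eq zq => //= u q IH x /andP[/and3P[_ _ uX] eq].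
  by rewrite inE => /predU1P[->//|]; apply: IH eq.
apply: contraT => nxy.
pose K := [set z | connect e x z].
have KX : {subset K <= X}.
  move=> z; rewrite inE => /connectP[p ep ->].
  case: (lastP p) ep => // s u; rewrite rcons_path last_rcons.
  by case/andP=> _ /and3P[].
have closed f u : mates [set: G] f -> u \in K -> f u \in X -> f u \in K.
  move=> Tf uK fuX; have [_ uf _] := Tf u (in_setT u).
  move: (uK); rewrite !inE => xu; apply: connect_trans xu (connect1 _).
  by rewrite /e uf fuX KX.
have xK : x \in K by rewrite inE connect0.
have yK : y \notin K by rewrite inE.
have [f [Tf fy Sf]] := crossing_mates yy' yX ny'X.
have [g [Tg gx Sg]] := crossing_mates xx' xX nx'X.
have Kf : mates K f.
  move=> u uK; have [_ uf fK] := Tf u (in_setT u); split=> //.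
  apply: closed => //; have [|] := Sf u; last by rewrite inE => /andP[].
  by rewrite !inE KX // andbT; apply: contraNneq yK => <-.
have Kg : mates (K :\ x) g.
  move=> u /setD1P[ux uK]; have [_ ug gK] := Tg u (in_setT u).
  have [|] := Sg u; first by rewrite !inE ux KX.
  by case/setD1P=> gux guX _ _; split; rewrite // inE closed // !inE gux.
have bip := skeleton_bipartite skG.
have := mates_even bip Kf; have := mates_even bip Kg.
by rewrite (cardsD1 x K) xK /= negbK => /negPf->.
Qed.

(** A set S on which a perfect matching closes up, and which swallows X except
    perhaps a, corresponds to a vertex set of the contraction; the matching of
    its complement carries over. *)
Lemma conformal_contract (a : G) (S : {set G}) f (c : seq (contract X)) :
    a \in X -> X :\ a \subset S -> mates [set: G] f -> mates S f ->
    (forall u, (unproj a u \in S) = (u \in c)) ->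
  conformal_mates c.
Proof.
move=> aX /subsetP XS Tf Sf cE.
have sub x : x \notin S -> x \in X -> x = a.
  move=> nxS xX; apply: contraNeq nxS => xa; apply: XS.
  by rewrite !inE xa.
have := matesD Tf Sf; rewrite setTD => Cf.
have [|g [Sg _]] := @mates_proj _ X _ _ _ Cf.
  move=> x y; rewrite !inE => nxS nyS /eqP.
  rewrite proj_eq => /orP[/eqP//|/andP[xX yX]].
  by rewrite (sub x nxS xX) (sub y nyS yX).
exists g; rewrite (_ : ~: _ = proj X @: (~: S)) //.
apply/setP => u; rewrite !inE -cE; apply/idP/imsetP => [nS|[x]].
  by exists (unproj a u); rewrite ?inE // unprojK.
rewrite inE => nxS ->; rewrite unproj_proj; case: ifP => // xX.
by rewrite -(sub x nxS xX).
Qed.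

Lemma unproj_adj z (u v : contract X) : u != None -> v != None ->
  adj u v = adj (unproj z u) (unproj z v).
Proof. by case: u v => [u|] [v|]. Qed.

Lemma unproj_adj_None (u : contract X) : adj u None ->
  exists2 z, z \in X & forall y, adj (unproj y u) z.
Proof. by case: u => // u /exists_inP[z zX uz]; exists z. Qed.

Lemma unproj_path z (u : contract X) s : None \notin u :: s ->
  path (@adj (contract X)) u s = path (@adj G) (unproj z u) (map (unproj z) s).
Proof.
elim: s u => // v s IH u; rewrite 2!inE !negb_or => /and3P[uN vN sN].
rewrite map_cons !adj_path_cons -unproj_adj 1?eq_sym // IH //.
by rewrite inE negb_or vN.
Qed.

(** In both cases below C is the vertex set of a cycle of G and f a perfect
    matching made of one avoiding C and one along C; f closes up on the shore
    minus its crossing vertex, hence on the union of that with C. *)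
Lemma cycles_conformal_contract :
  cycles_conformal G -> cycles_conformal (contract X).
Proof.
move=> ccG c cyc; have bip := skeleton_bipartite skG.
have [Nc|nNc] := boolP (None \in c).
  have [n p def] := rot_to Nc; apply: (@conformal_mates_rot _ n).
  have := is_cycle_rot n cyc; rewrite {}def => {cyc Nc c} -[sp].
  case: p sp => // u p sp /andP[].
  rewrite cycle_cons2 cons_uniq => /and3P[Nu pu uN] /andP[nNp uni].
  rewrite adj_sym in Nu.
  have [b bX ub] := unproj_adj_None uN; have [b0 b0X ub0] := unproj_adj_None Nu.
  have nX v : v \in u :: p -> unproj b v \notin X.
    by move=> vp; rewrite unproj_in //; apply: contraNneq nNp => <-.
  have [q [bq qb0 uniq_q qX]] : exists q, [/\ path (@adj G) b q, last b q = b0,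
      uniq (b :: q) & {subset b :: q <= X}].
    apply: (shore_path bX b0X (nX _ (mem_last u p)) (nX _ (mem_head u p))).
      by rewrite adj_sym.
    by rewrite adj_sym.
  (* Replace the contracted vertex by the path b :: q inside X. *)
  set pG := map (unproj b) (u :: p).
  have cycG : is_cycle (b :: q ++ pG).
    split.
      rewrite /= size_cat size_map /= addnS !ltnS.
      by case: (p) sp => // ? ? _; rewrite /= addnS.
    apply/andP; split.
      rewrite /= rcons_cat cat_path bq qb0 /= adj_sym ub0 rcons_path.
      by rewrite last_map ub -unproj_path // pu.
    rewrite -cat_cons cat_uniq uniq_q map_inj_uniq; last exact: unproj_inj.
    rewrite uni andbT.
    by apply/hasPn => _ /mapP[v /nX nvX ->]; apply: contra nvX => /qX.
  have [h Sh] := ccG _ cycG; case: (cycG) => _ ucG.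
  have [g Sg gb] := cycle_mates bip ucG.
  set C := [set x in b :: q ++ pG] in Sh Sg.
  have [|f [Tf fh fg]] := mates_glue _ Sh Sg; first by rewrite disjoints_subset.
  rewrite setUC setUCr in Tf.
  have bC : b \in C by rewrite inE mem_head.
  (* The cycle is matched backwards at b, that is, along its cut edge at b, so
     this is the one place where f crosses. *)
  have fb : f b \notin X.
    rewrite fg // gb last_cat /= last_map; exact: nX (mem_last u p).
  have [a [aX nfa unia]] := tight_mates tX Tf.
  have ba := unia _ bX fb; subst a.
  have Sf := mates_shore Tf bX nfa unia.
  have Cf : mates C f by apply: eq_mates Sg => x /fg.
  apply: (conformal_contract bX _ Tf (matesU Sf Cf)); first exact: subsetUl.
  move=> v; rewrite in_setU [_ \in C]inE in_setD1 unproj_in //.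
  have [->|vN] := eqVneq v None; first by rewrite [RHS]mem_head mem_head orbT.
  rewrite andbF -cat_cons mem_cat (mem_map (unproj_inj bX)) [RHS]inE (negPf vN).
  by rewrite (contraFF (qX _)) // unproj_in // (negPf vN).
case: c cyc nNc => [[]//|u c cyc nNc].
have [b bX] : exists b, b \in X.
  have [f Tf] := skeleton_mates skG.
  by have [b [bX _ _]] := tight_mates tX Tf; exists b.
have cycG : is_cycle (map (unproj b) (u :: c)).
  case: cyc => sc /andP[cyc uni].
  have uniG : uniq (map (unproj b) (u :: c)).
    by rewrite map_inj_uniq //; apply: unproj_inj.
  split; first by rewrite /= size_map.
  apply/andP; split; last exact: uniG.
  move: cyc; rewrite {1}/cycle (unproj_path b) ?map_rcons //.
  by rewrite inE mem_rcons !inE orbA orbb -in_cons.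
have [h Sh] := ccG _ cycG; case: (cycG) => _ ucG.
have [g Sg _] := cycle_mates bip ucG.
set C := [set x in _] in Sh; rewrite -[[set y in _]]/C in Sg.
have [|f [Tf fh fg]] := mates_glue _ Sh Sg; first by rewrite disjoints_subset.
rewrite setUC setUCr in Tf.
have [a [aX nfa uni]] := tight_mates tX Tf.
have Sf := mates_shore Tf aX nfa uni.
have Cf : mates C f by apply: eq_mates Sg => x /fg.
apply: (conformal_contract aX _ Tf (matesU Sf Cf)); first exact: subsetUl.
move=> v; rewrite in_setU [_ \in C]inE in_setD1 unproj_in //.
have [->|vN] := eqVneq v None.
  rewrite eqxx andFb orFb (negPf nNc); apply/negbTE/mapP => -[w wc aw].
  have : unproj b w \in X by rewrite -aw.
  by rewrite unproj_in // => /eqP ew; rewrite -ew wc in nNc.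
rewrite andbF orFb; case: v vN => // v _.
rewrite -[unproj a _]/(unproj b (Some v : contract X)).
by rewrite -[RHS](mem_map (unproj_inj bX)).
Qed.

End Transfer.

(** * Conformality lifts from the contractions *)

Section Glue.
Variables (G : sgraph) (X : {set G}).
Hypotheses (skG : cubic_skeleton G) (tX : tight X).
Hypothesis ccX : cycles_conformal (contract X).

Lemma proj_path (x : G) s : {in x :: s, forall y, y \notin X} ->
  path (@adj G) x s -> path (@adj (contract X)) (proj X x) (map (proj X) s).
Proof.
elim: s x => // y s IH x nX; rewrite map_cons.
rewrite !adj_path_cons => /andP[xy ys]; rewrite IH ?andbT //; last first.
  by move=> z zs; apply: nX; rewrite inE zs orbT.
apply: proj_adj => //; rewrite proj_eq negb_or (negPf (nX x _)) ?mem_head //.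
by rewrite andbT; apply: contraTneq xy => ->; rewrite adj_irrefl.
Qed.

Lemma proj_uniq (s : seq G) : {in s, forall y, y \notin X} -> uniq s ->
  uniq (map (proj X) s).
Proof.
move=> nX us; rewrite map_inj_in_uniq // => x y xs ys /eqP.
by rewrite proj_eq (negPf (nX x xs)) orbF => /eqP.
Qed.

Lemma mem_proj (s : seq G) x : {in s, forall y, y \notin X} ->
  (proj X x \in map (proj X) s) = (x \in s).
Proof.
move=> nX; apply/mapP/idP => [[y ys /eqP]|xs]; last by exists x.
by rewrite proj_eq (negPf (nX y ys)) andbF orbF => /eqP->.
Qed.

Lemma None_proj (s : seq G) : {in s, forall y, y \notin X} ->
  None \notin map (proj X) s.
Proof.
move=> nX; apply/mapP => -[y /nX]; rewrite -proj_None => nN e.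
by rewrite -e in nN.
Qed.

(** The matching g of the contraction matches the contracted vertex; choose z in
    X below that edge.  A perfect matching of G through the same edge crosses
    nowhere else, so it matches the rest of X with itself. *)
Lemma shore_cycle_conformal (c : seq G) : is_cycle c ->
  {in c, forall x, x \notin X} -> conformal_mates c.
Proof.
case: c => [[]//|x s] [sc /andP[cyc uni]] nX.
have cycX : @is_cycle (contract X) (map (proj X) (x :: s)).
  split; first by rewrite size_map.
  rewrite /ucycle proj_uniq // andbT.
  have: path (@adj (contract X)) (proj X x) (map (proj X) (rcons s x)).
    apply: proj_path => // y.
    by rewrite inE mem_rcons inE orbA orbb -in_cons => /nX.
  by rewrite map_rcons.
have [g Sg] := ccX cycX; have nNc := None_proj nX.
set D := ~: _ in Sg.
have ND : None \in D by rewrite !inE.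
have [_ Ng gN] := Sg None ND; rewrite adj_sym in Ng.
have [z zX zg] := unproj_adj_None Ng; set v := unproj z (g None).
have nvX : v \notin X.
  by rewrite unproj_in //; apply: contraTneq Ng => ->; rewrite adj_irrefl.
have gD : {in D, forall w, adj (unproj z w) (unproj z (g w))}.
  move=> w wD; have [_ wg gK] := Sg w wD.
  have [->|wN] := eqVneq w None; first by rewrite adj_sym.
  have [gwN|gwN] := eqVneq (g w) None; last by rewrite -unproj_adj.
  have -> : w = g None by rewrite -gwN gK.
  by rewrite gN; apply: zg.
have [h [Sh hE]] := mates_push (in2W (unproj_inj zX)) Sg gD.
have zv : adj z v by rewrite adj_sym; apply: zg.
have [k [Tk kz Sk]] := crossing_mates skG tX zv zX nvX.
have [|f [Sf _ _]] := mates_glue _ Sk Sh.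
  apply/pred0P => w /=; apply/andP => -[/setD1P[wz wX] /imsetP[u uD wu]].
  move: wX; rewrite wu unproj_in // => /eqP uN.
  by rewrite wu uN eqxx in wz.
exists f; move: Sf; set A := _ :|: _; suff -> : A = ~: [set y in x :: s] by [].
apply/setP => w; rewrite in_setU in_setD1 in_setC in_set.
have [wX|nwX] := boolP (w \in X).
  rewrite (contraTN (nX w)) ?wX // andbT; case: eqVneq => // ->.
  by rewrite -[z in z \in _]/(unproj z (None : contract X)) imset_f.
rewrite andbF -[w in w \in _](projK z nwX) mem_imset ?in_setC ?in_set.
  by rewrite mem_proj.
exact: unproj_inj.
Qed.

(** With both cut edges attached, the arc becomes a cycle through the contracted
    vertex.  If the arc is a single vertex this is a single edge instead of a
    cycle, and a perfect matching through that edge does the same job. *)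
Lemma shore_arc_mates (v : G) t (x y : G) :
    {in v :: t, forall z, z \notin X} -> path (@adj G) v t -> uniq (v :: t) ->
    x \in X -> y \in X -> adj x v -> adj (last v t) y ->
  exists f, mates (~: X :\: [set z in v :: t]) f.
Proof.
case: t => [|u t] nX vt uni xX yX xv ty.
  have nvX : v \notin X by apply: nX; rewrite mem_head.
  have [k [Tk kx Sk]] := crossing_mates skG tX xv xX nvX.
  have kv : k v = x by have [_ _] := Tk x (in_setT x); rewrite kx.
  have Pk : mates [set x; v] k.
    move=> z /set2P[]->; rewrite ?kx ?kv !inE eqxx ?orbT; split=> //.
    by rewrite adj_sym.
  exists k; have := matesD Tk (matesU Sk Pk); rewrite setTD.
  rewrite (_ : ~: _ = ~: X :\: [set z in [:: v]]) //.
  apply/setP => z; rewrite !inE; case: (eqVneq z x) => [->|_] /=.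
    by rewrite xX andbF.
  by rewrite negb_or andbC.
set p := v :: u :: t in nX uni *.
have nNp := None_proj nX.
have pE : map (proj X) p = proj X v :: map (proj X) (u :: t) by [].
have cycX : @is_cycle (contract X) (None :: map (proj X) p).
  split; first by rewrite /= size_map.
  apply/andP; split; last by rewrite cons_uniq nNp proj_uniq.
  rewrite pE cycle_cons2 proj_path // last_map.
  have pN z : z \in X -> proj X z = None by rewrite -proj_None => /eqP.
  rewrite -{1}(pN x xX) -(pN y yX) !proj_adj //.
    rewrite proj_eq (negPf (nX _ (mem_last v _))) orbF.
    by apply: contraTneq ty => ->; rewrite adj_irrefl.
  rewrite proj_eq (negPf (nX _ (mem_head v _))) andbF orbF.
  by apply: contraTneq xv => ->; rewrite adj_irrefl.
clearbody p; have [g Sg] := ccX cycX; set D := ~: _ in Sg.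
have DN w : w \in D -> w != None.
  by rewrite !inE; apply: contraNneq => ->; rewrite eqxx.
have gD : {in D, forall w, adj (unproj x w) (unproj x (g w))}.
  by move=> w wD; have [gwD wg _] := Sg w wD; rewrite -unproj_adj ?DN.
have [h [Sh _]] := mates_push (in2W (unproj_inj xX)) Sg gD.
exists h; rewrite (_ : _ :\: _ = unproj x @: D) //.
apply/setP => z; rewrite !inE; apply/andP/imsetP => [[nzp nzX]|[w wD ->]].
  exists (proj X z); last by rewrite projK.
  by rewrite !inE negb_or proj_None nzX mem_proj.
rewrite unproj_in // DN //; split=> //.
move: wD; rewrite !inE negb_or => /andP[_]; apply: contra => wp.
by rewrite -(unprojK xX w) mem_proj.
Qed.

End Glue.

(** * A cycle crosses a tight cut at most twice *)

Lemma split_prefix (T : Type) (P : pred T) (s : seq T) :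
  exists s1 s2, [/\ s = s1 ++ s2, all P s1 &
    if s2 is x :: _ then ~~ P x else true].
Proof.
elim: s => [|x s [s1 [s2 [-> P1 P2]]]]; first by exists [::], [::].
case Px: (P x); last by exists [::], (x :: s1 ++ s2); rewrite Px.
by exists (x :: s1), s2; rewrite /= Px.
Qed.

(** Starting a cyclic sequence at an entry into P gives a run s in P followed by
    a rest that begins and ends outside P. *)
Lemma rot_arcs (T : eqType) (P : pred T) (c : seq T) x y :
    x \in c -> P x -> y \in c -> ~~ P y ->
  exists n x0 s y0 t, [/\ rot n c = (x0 :: s) ++ y0 :: t, all P (x0 :: s),
     ~~ P y0 & ~~ P (last y0 t)].
Proof.
move=> xc Px yc nPy; have [n c' def] := rot_to yc.
have [r1 [r2 [def_c' nP1 P2]]] := split_prefix (predC P) c'.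
have xc' : x \in r2.
  have : x \in rot n c by rewrite mem_rot.
  rewrite def def_c' inE mem_cat => /or3P[/eqP e|/(allP nP1)/=|//].
    by rewrite -e Px in nPy.
  by rewrite Px.
case: r2 P2 def_c' xc' => // x0 r2; rewrite negbK => Px0 def_c' _.
have [s1 [s2 [def_r2 P1 nP2]]] := split_prefix P (r2 ++ [:: y]).
have last_nP : ~~ P (last y r1).
  by have := mem_last y r1; rewrite inE => /predU1P[->//|/(allP nP1)].
have rotE : rot (size r1).+1 (rot n c) = x0 :: (r2 ++ [:: y]) ++ r1.
  by rewrite def def_c' (rot_size_cat (y :: r1) (x0 :: r2)) -catA.
case: s2 def_r2 nP2 => [|y0 t] def_r2 nP2.
  have : y \in s1 by rewrite -[s1]cats0 -def_r2 mem_cat mem_seq1 eqxx orbT.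
  by move/(allP P1); rewrite (negPf nPy).
have [m rotm] : exists m, rot m c = rot (size r1).+1 (rot n c).
  rewrite (rot_minn (size r1).+1) (rot_minn n).
  by rewrite rot_add_mod ?size_rot ?geq_minr //; eexists.
exists m, x0, s1, y0, (t ++ r1); split.
- by rewrite rotm rotE def_r2 /= -catA.
- by rewrite /= Px0.
- by [].
have : last x0 (r2 ++ [:: y]) = last y0 t by rewrite def_r2 last_cat.
by rewrite cats1 last_rcons last_cat => <-.
Qed.

Lemma ucycle_cat2 (G : sgraph) (x0 y0 : G) s t :
  ucycle (@adj G) ((x0 :: s) ++ y0 :: t) ->
  [/\ [/\ path (@adj G) x0 s, adj (last x0 s) y0, path (@adj G) y0 t
         & adj (last y0 t) x0],
      uniq (x0 :: s), uniq (y0 :: t)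
    & {in x0 :: s, forall z, z \notin y0 :: t}].
Proof.
case/andP; rewrite cat_cons [cycle _ _]/= rcons_cat cat_path rcons_cons.
rewrite [path _ _ (y0 :: _)]/= rcons_path => /and4P[ps sy pt tx].
rewrite -cat_cons cat_uniq => /and3P[us dis ut].
split=> // z zs; apply/negP => zt; case/hasP: dis; by exists z.
Qed.

(** If the second part t came back to X, it would have to leave again since it
    ends outside X; the cycle would then contain four distinct cut edges. *)
Lemma cycle_crosses_twice (G : sgraph) (X : {set G}) (x0 y0 : G) s t :
    cubic_skeleton G -> tight X -> ucycle (@adj G) ((x0 :: s) ++ y0 :: t) ->
    {subset x0 :: s <= X} -> y0 \notin X -> last y0 t \notin X ->
  {in y0 :: t, forall z, z \notin X}.
Proof.
move=> skG tX /ucycle_cat2[[_ sy pt tx] _ ut dis] sX ny0 nlt.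
have [r1 [r2 [def_t nP1 P2]]] := split_prefix (predC (mem X)) (y0 :: t).
case: r2 def_t P2 => [|x1 r2] def_t P2.
  by rewrite def_t cats0 => z /(allP nP1).
have x1X : x1 \in X by rewrite /= negbK in P2.
case: r1 def_t nP1 => [[e _]|y1 r1 [<- def_t] nP1].
  by move: ny0; rewrite e /= x1X.
have [u [v [def_r2 Pu nPv]]] := split_prefix (mem X) r2.
have {}Pu : {subset x1 :: u <= X}.
  by move=> z; rewrite inE => /predU1P[->//|/(allP Pu)].
case: v def_r2 nPv => [|v0 v] def_r2 nv0.
  rewrite def_t last_cat def_r2 cats0 in nlt.
  by rewrite /= Pu ?mem_last in nlt.
have {}nP1 : {in y0 :: r1, forall z, z \notin X} by move=> z /(allP nP1).
have tE : y0 :: t = (y0 :: r1) ++ (x1 :: u) ++ v0 :: v.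
  by rewrite def_t def_r2.
have ltE : last y0 t = last v0 v.
  by rewrite def_t def_r2 !last_cat /= last_cat.
move: pt; rewrite def_t def_r2 cat_path [path _ _ (x1 :: _)]/= cat_path.
rewrite [path _ _ (v0 :: _)]/= => /and5P[_ r1x1 _ uv0 _].
have neqX a b : a \in x0 :: s -> b \in x1 :: u -> (a == b) = false.
  move=> sa ub; apply: contraNF (dis a sa) => /eqP->.
  by rewrite tE !mem_cat ub orbT.
have neqY a b : a \in y0 :: r1 -> b \in v0 :: v -> (a == b) = false.
  move=> ra vb; apply: contraTF ut => /eqP e; rewrite tE cat_uniq.
  rewrite negb_and orbC negb_and negbK; apply/orP; left; apply/orP; left.
  by apply/hasP; exists b; rewrite ?mem_cat ?vb ?orbT -?e.
pose cr := [:: (x0, last y0 t); (last x0 s, y0);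
               (x1, last y0 r1); (last x1 u, v0)].
suff: size cr <= 3 by [].
apply: (cut_cross_bound skG tX) => [|p].
  have [hx lx] := (mem_head x0 s, mem_last x0 s).
  have [hu lu] := (mem_head x1 u, mem_last x1 u).
  have [hr lr] := (mem_head y0 r1, mem_last y0 r1).
  have [hv lv] := (mem_head v0 v, mem_last v0 v).
  rewrite /cr ltE /= !inE !xpair_eqE [last v0 v == y0]eq_sym.
  rewrite (neqX _ _ hx hu) (neqX _ _ hx lu) (neqX _ _ lx hu) (neqX _ _ lx lu).
  by rewrite (neqY _ _ hr lv) (neqY _ _ lr hv) !andbF.
rewrite !inE => /or4P[] /eqP-> /=.
- by rewrite adj_sym sX ?mem_head.
- by rewrite sX ?mem_last.
- by rewrite adj_sym Pu ?mem_head // nP1 ?mem_last.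
- by rewrite Pu ?mem_last.
Qed.

(** * The theorem *)

Lemma cycles_conformal_tight_cut (G : sgraph) (X : {set G}) :
    cubic_skeleton G -> tight X ->
  cycles_conformal G <->
    cycles_conformal (contract X) /\ cycles_conformal (contract (~: X)).
Proof.
move=> skG tX; have tC := tight_setC tX; split=> [ccG|[ccX ccC] c cyc].
  by split; apply: cycles_conformal_contract.
have [allX|] := boolP (all (mem X) c).
  apply: (shore_cycle_conformal skG tC ccC cyc) => x /(allP allX) /=.
  by rewrite in_setC negbK.
case/allPn=> y yc nyX.
have [|] := boolP (all (predC (mem X)) c).
  by move/allP; apply: (shore_cycle_conformal skG tX ccX cyc).
case/allPn=> x xc; rewrite negbK => xX.
have [n [x0 [s [y0 [t [def sX ny0 nlt]]]]]] := rot_arcs xc xX yc nyX.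
apply: (@conformal_mates_rot _ n).
have := is_cycle_rot n cyc; rewrite {}def => -[_ ucyc].
have [[ps sy pt tx] us ut _] := ucycle_cat2 ucyc.
have {}sX : {subset x0 :: s <= X} by move=> z /(allP sX).
have tnX := cycle_crosses_twice skG tX ucyc sX ny0 nlt.
have [f Sf] := shore_arc_mates skG tX ccX tnX pt ut
  (sX _ (mem_last x0 s)) (sX _ (mem_head x0 s)) sy tx.
have sC : {in x0 :: s, forall z, z \notin ~: X}.
  by move=> z /sX; rewrite inE negbK.
have [g Sg] : exists g, mates (~: ~: X :\: [set z in x0 :: s]) g.
  by apply: (shore_arc_mates skG tC ccC sC ps us _ _ tx sy);
     rewrite inE tnX ?mem_last ?mem_head.
have [|h [Sh _ _]] := mates_glue _ Sf Sg.
  rewrite setCK disjoints_subset; apply/subsetP => z; rewrite !inE.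
  by case/andP=> _ /negPf->; rewrite andbF.
exists h; set U := _ :|: _ in Sh; rewrite (_ : ~: _ = U) //; apply/setP => z.
rewrite in_setC in_set mem_cat in_setU !in_setD setCK in_setC !in_set.
have [zX|nzX] := boolP (z \in X).
  by rewrite andbF andbT negb_or (contraTN (tnX z)) ?zX ?andbT ?orbF.
by rewrite andbF orbF andbT negb_or (contraNN (@sX z)).
Qed.

(** Generalised from cubic graphs to cubic skeletons, which the induction needs.
    All graphs that occur are bipartite, so each graph of L counts as a
    brace. *)
Lemma cycle_conformal_decomposition (G : sgraph) (L : seq sgraph) :
    tight_cut_decomposition G L -> cubic_skeleton G ->
  (cycle_conformal G <-> forall H : sgraph, brace_in L H -> cycle_conformal H).
Proof.
have ccE (H : sgraph) :
    cubic_skeleton H -> cycle_conformal H <-> cycles_conformal H.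
  move=> skH; have bip := skeleton_bipartite skH.
  rewrite bipartite_cycle_conformalP //; split=> [[]//|]; split=> //.
  exact: skeleton_mates skH.
elim=> {G L} [G _|G X L1 L2 tX _ _ IH1 _ IH2] skG.
  split=> [ccG H [[<-|[]] _]//|]; apply; split; first by left.
  exact: skeleton_bipartite skG.
have tC := tight_setC tX.
have sk1 := contract_skeleton skG tX; have sk2 := contract_skeleton skG tC.
rewrite ccE // (cycles_conformal_tight_cut skG tX) -!ccE // IH1 // IH2 //.
split=> [[cc1 cc2] H [HL bipH]|cc].
  by case: (List.in_app_or _ _ _ HL) => HL'; [apply: cc1|apply: cc2].
split=> H [HL bipH]; apply: cc; split=> //.
  by apply: List.in_or_app; left.
by apply: List.in_or_app; right.
Qed.

Theorem lemma1p7 (G : sgraph) (L : seq sgraph) :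
  cubic G -> matching_covered G -> bipartite G ->
  tight_cut_decomposition G L ->
  (cycle_conformal G <-> forall H : sgraph, brace_in L H -> cycle_conformal H).
Proof.
move=> cubG mcG bipG decG; apply: cycle_conformal_decomposition decG _.
exact: cubic_cubic_skeleton.
Qed.
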